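(* Let $N\ge 1$, $P\in\mathbb{R}^{N\times N}$, $B\in\mathbb{R}^N$, let $(i_n)_{n\ge 1}$ be any sequence in $\{1,\dots,N\}$, and let $(\alpha_n)_{n\ge 1}$ be any sequence of reals with $\alpha_n\ge 0$. Let $(F^{\alpha}_n,H^{\alpha}_n)_{n\ge 0}$ be the diffusion iteration associated with $(P,B)$, $(i_n)$ and $(\alpha_n)$. Then for all $n\ge 0$, $$H^{\alpha}_n+F^{\alpha}_n=P\,H^{\alpha}_n+B.$$
   Context: $I_d$ is the $N\times N$ identity matrix, and $J_i$ is the $N\times N$ matrix whose entries are all zero except the $i$-th diagonal entry, which equals $1$. The diffusion iteration associated with $(P,B)$, the node sequence $(i_n)_{n\ge1}$ and the weights $(\alpha_n)_{n\ge1}$ is the pair of sequences of vectors in $\mathbb{R}^N$ defined by $F^{\alpha}_0=B$, $H^{\alpha}_0=0$, and for $n\ge 1$, $$F^{\alpha}_n=\bigl(I_d+\alpha_n(P-I_d)J_{i_n}\bigr)F^{\alpha}_{n-1},\qquad H^{\alpha}_n=H^{\alpha}_{n-1}+\alpha_n J_{i_n}F^{\alpha}_{n-1}.$$ *)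

(* Defs.v *)
From mathcomp Require Import all_boot all_order all_algebra.
From mathcomp Require Import reals.

Set Implicit Arguments.
Unset Strict Implicit.
Unset Printing Implicit Defensive.

Import GRing.Theory Num.Theory.
Local Open Scope ring_scope.

(* J_k is the library's [delta_mx k k]. The sequences i and alpha are indexed
   from 1, so their values at 0 are never used. *)
Fixpoint diffusion_F (R : realType) (N : nat) (P : 'M[R]_N) (B : 'cV[R]_N)
    (i : nat -> 'I_N) (alpha : nat -> R) (n : nat) : 'cV[R]_N :=
  if n is m.+1 then
    (1%:M + alpha m.+1 *: ((P - 1%:M) *m delta_mx (i m.+1) (i m.+1)))
      *m diffusion_F P B i alpha m
  else B.

Fixpoint diffusion_H (R : realType) (N : nat) (P : 'M[R]_N) (B : 'cV[R]_N)
    (i : nat -> 'I_N) (alpha : nat -> R) (n : nat) : 'cV[R]_N :=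
  if n is m.+1 then
    diffusion_H P B i alpha m
      + alpha m.+1 *: (delta_mx (i m.+1) (i m.+1) *m diffusion_F P B i alpha m)
  else 0.

(* Main.v *)
Require Import Defs.
From mathcomp Require Import all_boot all_order all_algebra.
From mathcomp Require Import reals.

Import GRing.Theory Num.Theory.
Local Open Scope ring_scope.

Theorem theorem3 (R : realType) (N : nat) (hN : (1 <= N)%N)
    (P : 'M[R]_N) (B : 'cV[R]_N) (i : nat -> 'I_N) (alpha : nat -> R)
    (halpha : forall n : nat, (1 <= n)%N -> 0 <= alpha n) :
  forall n : nat,
    diffusion_H P B i alpha n + diffusion_F P B i alpha n
      = P *m diffusion_H P B i alpha n + B.
Proof.
elim=> [|n IHn] /=; first by rewrite mulmx0.
(* [X] is the amount diffused at this step: H gains [X] and F gains [(P - 1) X], so H + F and P H +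
   B both grow by [P X] and the invariant is preserved. *)
set X := alpha _ *: (delta_mx _ _ *m _).
(* Brings the new F to the form F + [(P - 1) X]. *)
rewrite mulmxDl mul1mx -scalemxAl -mulmxA scalemxAr -/X.
(* [IHn] replaces P H + B by H + F; the [X] gained by H cancels the [- X] in F, leaving [P X] on
   each side. *)
by rewrite mulmxBl mul1mx mulmxDr [RHS]addrAC -IHn addrACA [X + _]addrC subrK.
Qed.
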